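(* Let $2\le k\le mn$, let $p_x\in\mathcal{P}_k$, let $\mathcal{D}$ be an open connected subset of $\mathbb{C}$, and let $F:\mathcal{D}\rightarrow M_{m\times n}(\mathbb{C})$ be a function whose entries are analytic (holomorphic) functions on $\mathcal{D}$. Let $\mathcal{Z}_{p_x}(\mathcal{D})=\{z\in\mathcal{D} : F(z)\text{ has repeated zeros with respect to } p_x\}$. Then either $\mathcal{Z}_{p_x}(\mathcal{D})=\mathcal{D}$ or $\mathcal{Z}_{p_x}(\mathcal{D})$ has no limit points in $\mathcal{D}$.
   Context: $M_{m\times n}(\mathbb{C})$ is the set of $m\times n$ complex matrices. Let $\mathbb{C}_k[x]$ be the set of complex polynomials of degree $k$ and $\mathbb{C}^k_{\mathrm{sym}}$ the set of unordered $k$-tuples of complex numbers; $r_k:\mathbb{C}_k[x]\to\mathbb{C}^k_{\mathrm{sym}}$ sends a polynomial to the unordered $k$-tuple of its roots (with multiplicity). $\mathcal{P}_k$ is the set of maps $p_x:M_{m\times n}(\mathbb{C})\to\mathbb{C}_k[x]$ of the form $p_x(A)=x^k+\sum_{i=1}^{k}q_i(A)x^{i-1}$, where each $q_i(A)$ is a polynomial function of the entries of $A$, such that $r_k(p_x(M_{m\times n}(\mathbb{C})))=\mathbb{C}^k_{\mathrm{sym}}$. A number $z\in\mathbb{C}$ is a zero of $A$ with respect to $p_x$ if the polynomial $p_x(A)$ vanishes at $x=z$; $A$ has repeated zeros with respect to $p_x$ if $p_x(A)$ has a root of multiplicity at least $2$, and distinct zeros otherwise. *)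

(* Defs.v *)
From HB Require Import structures.
From mathcomp Require Import all_boot all_order all_algebra.
From mathcomp Require Import all_classical all_reals all_analysis.
From mathcomp Require Import complex.
From mathcomp Require mpoly.

Set Implicit Arguments.
Unset Strict Implicit.
Unset Printing Implicit Defensive.

Import Order.TTheory GRing.Theory Num.Theory.
Import numFieldNormedType.Exports.
Local Open Scope classical_set_scope.
Local Open Scope ring_scope.

(* The complex numbers: C = R[i] for a real field R : realType.  As a
   numFieldType, C carries its canonical normed-space structure over
   itself (numFieldNormedType), so [derivable f z 1] for f : C -> C is
   complex differentiability at z. *)

Definition mx_entries (K : nzRingType) (m n : nat) (A : 'M[K]_(m, n)) :
  'I_(m * n) -> K := fun i => mxvec A 0 i.

(* p_x(A) = x^k + sum_{i=1}^k q_i(A) x^(i-1); q is indexed by 'I_k, with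
   q i playing the role of q_{i+1}; each q_i is a polynomial in the mn
   entries of A. *)
Definition px (K : comNzRingType) (m n k : nat)
  (q : 'I_k -> mpoly.mpoly (m * n) K) (A : 'M[K]_(m, n)) : {poly K} :=
  'X^k + \sum_(i < k) (mpoly.meval (mx_entries A) (q i))%:P * 'X^i.

(* p_x belongs to P_k: r_k(p_x(M_{m x n})) is all of C^k_sym, i.e. every
   unordered k-tuple (multiset, given by a list s of size k) is the
   multiset of roots (with multiplicity) of some p_x(A). *)
Definition in_Pk (K : fieldType) (m n k : nat)
  (q : 'I_k -> mpoly.mpoly (m * n) K) : Prop :=
  forall s : seq K, size s = k ->
    exists A : 'M[K]_(m, n), forall z : K, mup z (px q A) = count_mem z s.

Definition repeated_zeros (K : fieldType) (m n k : nat)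
  (q : 'I_k -> mpoly.mpoly (m * n) K) (A : 'M[K]_(m, n)) : Prop :=
  exists z : K, (2 <= mup z (px q A))%N.

Definition holomorphic_on (R : realType) (D : set R[i]) (f : R[i] -> R[i]) :=
  forall z, D z -> derivable (f : R[i]^o -> R[i]^o) z 1.

(* Main.v *)
(* A matrix has repeated zeros iff the resultant g of p_x(F(z)) and its
   x-derivative vanishes, and g is holomorphic since it is the determinant of
   a Sylvester matrix of constant size.  What remains is the identity theorem for
   functions that are merely complex differentiable.  Goursat's bisection gives
   vanishing integrals over rectangles and hence
   f(w) N(w) = int f(z)/(z-w) dz over a square, where N(w) = int dz/(z-w) has
   positive imaginary part, as each of the four sides contributes positively.
   Expanding 1/(z-w) in powers of w with remainder, an accumulation of zeros at
   the centre kills every Taylor coefficient of the right-hand side, so f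
   vanishes near the centre; connectedness propagates this to the domain. *)
Require Import Defs.
From HB Require Import structures.
From mathcomp Require Import all_boot all_order all_algebra.
From mathcomp Require Import all_classical all_reals all_analysis.
From mathcomp Require Import complex.
From mathcomp Require mpoly.
From mathcomp Require Import ring lra.

Set Implicit Arguments.
Unset Strict Implicit.
Unset Printing Implicit Defensive.

Import Order.TTheory GRing.Theory Num.Theory.
Import numFieldNormedType.Exports.
Local Open Scope classical_set_scope.
Local Open Scope ring_scope.

(** * The complex modulus as a real number, and differentiability in epsilon-delta form *)

Local Notation cnorm := Normc.normc.

Lemma cnormE (R : realType) (z : R[i]) : `|z| = (cnorm z)%:C%C.
Proof. by []. Qed.

Lemma cnorm_ge0 (R : realType) (z : R[i]) : 0 <= cnorm z.
Proof. by rewrite -ler0c -cnormE. Qed.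

Lemma cnorm_gt0 (R : realType) (z : R[i]) : z != 0 -> 0 < cnorm z.
Proof. by rewrite -normr_gt0 cnormE ltcR. Qed.

Lemma normRe_le (R : realType) (z : R[i]) : `|complex.Re z| <= cnorm z.
Proof. by rewrite -lecR -cnormE; exact: normc_ge_Re. Qed.

Lemma normIm_le (R : realType) (z : R[i]) : `|complex.Im z| <= cnorm z.
Proof.
case: z => a b /=; rewrite -sqrtr_sqr ler_sqrt ?addr_ge0 ?sqr_ge0//.
by rewrite lerDr sqr_ge0.
Qed.

Lemma cnorm_le_ReIm (R : realType) (z : R[i]) :
  cnorm z <= `|complex.Re z| + `|complex.Im z|.
Proof.
case: z => a b /=; rewrite -(@ger0_norm _ (`|a| + `|b|)) ?addr_ge0//.
rewrite -sqrtr_sqr ler_sqrt ?sqr_ge0// sqrrD !real_normK ?num_real//.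
by rewrite -addrA lerD2l lerDr mulrn_wge0// mulr_ge0.
Qed.

Lemma cnormD_le (R : realType) (z w : R[i]) :
  cnorm (z + w) <= cnorm z + cnorm w.
Proof. exact: le_normcD. Qed.

Lemma cnormB_le (R : realType) (z w : R[i]) :
  cnorm (z - w) <= cnorm z + cnorm w.
Proof. by rewrite -(normcN w) cnormD_le. Qed.

(** A positive element of [R[i]] is real, so the balls of [R[i]^o], whose radii are elements of
    [R[i]], can be traded for balls of real radius. All later estimates then take place in [R]. *)
Lemma nbhs_cballP (R : realType) (z : R[i]) (A : set R[i]) :
  nbhs (z : R[i]^o) A <->
  exists2 d : R, 0 < d & forall w, cnorm (w - z) < d -> A w.
Proof.
split=> [/nbhs_ballP[e /= e0 sA]|[d d0 sA]].
  have eR : e = (complex.Re e)%:C%C by rewrite RRe_real// gtr0_real.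
  exists (complex.Re e); first by move: e0; rewrite {1}eR ltcR.
  move=> w wz; apply: sA; rewrite -ball_normE /ball_ /= distrC eR.
  by rewrite cnormE ltcR.
apply/nbhs_ballP; exists d%:C%C => /=; first by rewrite ltcR.
move=> w; rewrite -ball_normE /ball_ /= distrC cnormE ltcR.
exact: sA.
Qed.

(** This is the limit of the difference quotient multiplied through by [w - z], so that the estimate
    also covers [w = z]. *)
Lemma derivable_cball (R : realType) (f : R[i] -> R[i]) (z : R[i]) :
  derivable (f : R[i]^o -> R[i]^o) z 1 ->
  exists l : R[i], forall e : R, 0 < e -> exists2 d : R, 0 < d &
    forall w, cnorm (w - z) < d ->
      cnorm (f w - f z - l * (w - z)) <= e * cnorm (w - z).
Proof.
move=> /cvg_ex[/= l /cvgrPdist_le fl]; exists l => e e0.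
have /fl : 0 < e%:C%C :> R[i] by rewrite ltcR.
rewrite near_withinE => /nbhs_cballP[d d0 H]; exists d => // w wz.
have [->|wNz] := eqVneq w z.
  by rewrite !subrr mulr0 subrr Normc.normc0 mulr0.
have := H (w - z); rewrite subr0 subr_eq0 => /(_ wz wNz) /=.
rewrite cnormE lecR; rewrite /GRing.scale /= mulr1 subrK => h.
rewrite [X in cnorm X](_ : _ = - (l - (w - z)^-1 * (f w - f z)) * (w - z)); last first.
  by field; rewrite subr_eq0.
by rewrite Normc.normcM normcN ler_wpM2r// cnorm_ge0.
Qed.

Lemma continuous_ReC (R : realType) (z : R[i]) :
  {for z, continuous (@complex.Re R : R[i]^o -> R^o)}.
Proof.
move=> A /nbhs_ballP[e /= e0 sA]; apply/nbhs_cballP; exists e => // w wz.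
apply: sA; rewrite -ball_normE /ball_ /= distrC -raddfB.
by apply: le_lt_trans wz; exact: normRe_le.
Qed.

Lemma continuous_ImC (R : realType) (z : R[i]) :
  {for z, continuous (@complex.Im R : R[i]^o -> R^o)}.
Proof.
move=> A /nbhs_ballP[e /= e0 sA]; apply/nbhs_cballP; exists e => // w wz.
apply: sA; rewrite -ball_normE /ball_ /= distrC -raddfB.
by apply: le_lt_trans wz; exact: normIm_le.
Qed.

Lemma continuous_hline (R : realType) (y x : R) :
  {for x, continuous ((fun x : R => Complex x y) : R^o -> R[i]^o)}.
Proof.
move=> A /nbhs_cballP[d d0 sA]; apply/nbhs_ballP; exists d => // t.
rewrite -ball_normE /ball_ /= distrC => xt; apply: sA => /=.
by rewrite subrr expr0n addr0 sqrtr_sqr.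
Qed.

Lemma continuous_vline (R : realType) (x y : R) :
  {for y, continuous ((fun y : R => Complex x y) : R^o -> R[i]^o)}.
Proof.
move=> A /nbhs_cballP[d d0 sA]; apply/nbhs_ballP; exists d => // t.
rewrite -ball_normE /ball_ /= distrC => xt; apply: sA => /=.
by rewrite subrr expr0n add0r sqrtr_sqr.
Qed.

(** * Integrals of complex-valued functions over real segments *)

(** Integrating componentwise reduces linearity, additivity and estimates to real Lebesgue
    integrals. *)
Definition cint (R : realType) (a b : R) (u : R -> R[i]) : R[i] :=
  Complex (\int[lebesgue_measure]_(x in `[a, b]) complex.Re (u x))
          (\int[lebesgue_measure]_(x in `[a, b]) complex.Im (u x)).

(** Continuity is two-sided even at the endpoints. This is what differentiability on a closed
    rectangle provides on its sides, and it implies continuity within the segment. *)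
Definition continuous_itv (R : realType) (a b : R) (u : R -> R[i]) :=
  forall x, a <= x <= b -> {for x, continuous (u : R^o -> R[i]^o)}.

Lemma continuous_itv_within (R : realType) (a b : R) (u : R -> R[i]) :
  continuous_itv a b u ->
  {within `[a, b], continuous (@complex.Re R \o u : R -> R^o)} /\
  {within `[a, b], continuous (@complex.Im R \o u : R -> R^o)}.
Proof.
move=> cu; split; apply: continuous_in_subspaceT => x; rewrite inE /= in_itv /=
  => /cu xu.
  exact: (continuous_comp xu (@continuous_ReC R (u x))).
exact: (continuous_comp xu (@continuous_ImC R (u x))).
Qed.

Lemma continuous_itv_integrable (R : realType) (a b : R) (u : R -> R[i]) :
  continuous_itv a b u ->
  (@lebesgue_measure R).-integrable `[a, b] (EFin \o (@complex.Re R \o u)) /\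
  (@lebesgue_measure R).-integrable `[a, b] (EFin \o (@complex.Im R \o u)).
Proof.
move=> /continuous_itv_within[cR cI].
by split; apply: continuous_compact_integrable => //; exact: segment_compact.
Qed.

Lemma eq_cint (R : realType) (a b : R) (u v : R -> R[i]) :
  (forall x, a <= x <= b -> u x = v x) -> cint a b u = cint a b v.
Proof.
move=> uv; congr Complex; apply: eq_Rintegral => x;
  by rewrite inE /= in_itv /= => /uv ->.
Qed.

Lemma cintD (R : realType) (a b : R) (u v : R -> R[i]) :
  continuous_itv a b u -> continuous_itv a b v ->
  cint a b (fun x => u x + v x) = cint a b u + cint a b v.
Proof.
move=> /continuous_itv_integrable[uR uI] /continuous_itv_integrable[vR vI].
rewrite /cint; apply/eqP; rewrite eq_complex /=; apply/andP; split; apply/eqP.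
  by rewrite -RintegralD//; apply: eq_Rintegral => x _; rewrite raddfD.
by rewrite -RintegralD//; apply: eq_Rintegral => x _; rewrite raddfD.
Qed.

Lemma cintZ (R : realType) (a b : R) (k : R[i]) (u : R -> R[i]) :
  continuous_itv a b u -> cint a b (fun x => k * u x) = k * cint a b u.
Proof.
move=> /continuous_itv_integrable[uR uI].
have ZR r : (@lebesgue_measure R).-integrable `[a, b]
    (EFin \o (fun x => r * complex.Re (u x))).
  by apply: (integrableZl _ r uR).
have ZI r : (@lebesgue_measure R).-integrable `[a, b]
    (EFin \o (fun x => r * complex.Im (u x))).
  by apply: (integrableZl _ r uI).
case: k => p q; rewrite /cint; apply/eqP; rewrite eq_complex /=.
rewrite -!RintegralZl// -RintegralB// -RintegralD//.
by apply/andP; split; apply/eqP/eq_Rintegral => x _; case: (u x).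
Qed.

Lemma cintB (R : realType) (a b : R) (u v : R -> R[i]) :
  continuous_itv a b u -> continuous_itv a b v ->
  cint a b (fun x => u x - v x) = cint a b u - cint a b v.
Proof.
move=> /continuous_itv_integrable[uR uI] /continuous_itv_integrable[vR vI].
rewrite /cint; apply/eqP; rewrite eq_complex /=; apply/andP; split; apply/eqP.
  by rewrite -RintegralB//; apply: eq_Rintegral => x _; rewrite raddfB.
by rewrite -RintegralB//; apply: eq_Rintegral => x _; rewrite raddfB.
Qed.

Lemma cint_cst (R : realType) (a b : R) (k : R[i]) : a <= b ->
  cint a b (fun=> k) = (b - a)%:C%C * k.
Proof.
move=> ab; rewrite /cint !Rintegral_cst//= lebesgue_measure_itv /= lte_fin.
case: ltP => [_|ba]; last first.
  have -> : a = b by apply/eqP; rewrite eq_le ab.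
  by rewrite subrr !mulr0 mul0r.
by case: k => p q; rewrite -EFinB /=; simpc; rewrite ![_ * (b - a)]mulrC.
Qed.

Lemma cint_split (R : realType) (a m b : R) (u : R -> R[i]) :
  a <= m <= b -> continuous_itv a b u ->
  cint a b u = cint a m u + cint m b u.
Proof.
move=> /andP[am mb] /continuous_itv_integrable[uR uI].
have split_f (f : R -> R) : (@lebesgue_measure R).-integrable `[a, b] (EFin \o f) ->
  \int[lebesgue_measure]_(x in `[a, b]) f x =
  \int[lebesgue_measure]_(x in `[a, m]) f x +
  \int[lebesgue_measure]_(x in `[m, b]) f x.
  move=> fi; have := @Rintegral_itvB R f (BLeft a) (BRight b) m fi.
  rewrite !bnd_simp => /(_ am mb) /eqP; rewrite subr_eq => /eqP ->.
  (* The subtraction rule leaves the segment to the right of [m] half-open; the missing endpoint is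
     a null set. *)
  rewrite addrC -[X in _ = _ + X]Rintegral_itv_obnd_cbnd//.
  by apply: (integrableS _ _ _ fi) => //; apply: subset_itvr; rewrite bnd_simp.
by rewrite /cint (split_f _ uR) (split_f _ uI).
Qed.

(** The factor 2 comes from bounding the real and imaginary parts separately, each by [M * (b - a)].
    It is harmless, since only the order of magnitude of such bounds matters later. *)
Lemma cnorm_cint_le (R : realType) (a b M : R) (u : R -> R[i]) :
  a <= b -> continuous_itv a b u ->
  (forall x, a <= x <= b -> cnorm (u x) <= M) ->
  cnorm (cint a b u) <= 2 * M * (b - a).
Proof.
move=> ab cu uM; have [uR uI] := continuous_itv_integrable cu.
have H (f : R -> R) : (@lebesgue_measure R).-integrable `[a, b] (EFin \o f) ->
    (forall x, a <= x <= b -> `|f x| <= M) ->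
    `|\int[lebesgue_measure]_(x in `[a, b]) f x| <= M * (b - a).
  move=> fi fM; apply: le_trans (le_normr_Rintegral _ fi) _ => //.
  have -> : M * (b - a) = \int[lebesgue_measure]_(x in `[a, b]) M.
    have := congr1 (@complex.Re R) (cint_cst M%:C%C ab).
    by rewrite /cint /= mul0r subr0 mulrC.
  apply: le_Rintegral => //.
  - by move/integrable_norm : fi.
  - apply: continuous_compact_integrable; first exact: segment_compact.
    by move=> x; exact: cvg_cst.
apply: le_trans (cnorm_le_ReIm _) _; rewrite /cint /=.
rewrite -mulrA mulrDl !mul1r lerD// H// => x /uM; apply: le_trans.
  exact: normRe_le.
exact: normIm_le.
Qed.

(** By compactness the imaginary part attains a positive minimum, and the integral is at least that
    minimum times [b - a]. *)
Lemma Im_cint_gt0 (R : realType) (a b : R) (u : R -> R[i]) :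
  a < b -> continuous_itv a b u ->
  (forall x, a <= x <= b -> 0 < complex.Im (u x)) ->
  0 < complex.Im (cint a b u).
Proof.
move=> ab cu u0; have [uR uI] := continuous_itv_integrable cu.
have [_ cI] := continuous_itv_within cu.
have [c cab cmin] := EVT_min (ltW ab) cI.
have c0 : 0 < complex.Im (u c) by apply: u0; move: cab; rewrite in_itv.
rewrite /cint /=; apply: (@lt_le_trans _ _ ((b - a) * complex.Im (u c))).
  by rewrite mulr_gt0// subr_gt0.
have -> : (b - a) * complex.Im (u c) =
    \int[lebesgue_measure]_(x in `[a, b]) complex.Im (u c).
  have := congr1 (@complex.Re R) (cint_cst (complex.Im (u c))%:C%C (ltW ab)).
  by rewrite /cint /= mul0r subr0.
apply: le_Rintegral => //.
  apply: continuous_compact_integrable; first exact: segment_compact.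
  by move=> x; exact: cvg_cst.
Qed.

(** * Integrals along boundaries of rectangles *)

Definition frame (R : realType) (a b c d : R) : set R[i] :=
  [set z | [/\ a <= complex.Re z <= b, c <= complex.Im z <= d &
     [|| complex.Re z == a, complex.Re z == b, complex.Im z == c |
         complex.Im z == d]]].

(* The integral of [f z dz] over the positively oriented boundary of
   [[a, b] x [c, d]]. *)
Definition rect_int (R : realType) (f : R[i] -> R[i]) (a b c d : R) : R[i] :=
  (cint a b (fun x => f (Complex x c)) - cint a b (fun x => f (Complex x d))) +
  Complex 0 1 * (cint c d (fun y => f (Complex b y)) -
                 cint c d (fun y => f (Complex a y))).

Definition continuous_frame (R : realType) (f : R[i] -> R[i]) (a b c d : R) :=
  forall z, frame a b c d z -> {for z, continuous (f : R[i]^o -> R[i]^o)}.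

Lemma frame_sides (R : realType) (a b c d : R) (P : R[i] -> Prop) :
  a <= b -> c <= d -> (forall z, frame a b c d z -> P z) ->
  [/\ forall x, a <= x <= b -> P (Complex x c),
      forall x, a <= x <= b -> P (Complex x d),
      forall y, c <= y <= d -> P (Complex a y) &
      forall y, c <= y <= d -> P (Complex b y)].
Proof.
by move=> ab cd fP; split=> t tI; apply: fP; split=> //=;
  rewrite ?lexx ?ab ?cd ?eqxx ?orbT.
Qed.

Lemma continuous_frame_sides (R : realType) (f : R[i] -> R[i]) (a b c d : R) :
  a <= b -> c <= d -> continuous_frame f a b c d ->
  [/\ continuous_itv a b (fun x => f (Complex x c)),
      continuous_itv a b (fun x => f (Complex x d)),
      continuous_itv c d (fun y => f (Complex a y)) &
      continuous_itv c d (fun y => f (Complex b y))].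
Proof.
move=> ab cd /(frame_sides ab cd)[f1 f2 f3 f4]; split=> t tI.
- exact: (continuous_comp (@continuous_hline R c t) (f1 t tI)).
- exact: (continuous_comp (@continuous_hline R d t) (f2 t tI)).
- exact: (continuous_comp (@continuous_vline R a t) (f3 t tI)).
- exact: (continuous_comp (@continuous_vline R b t) (f4 t tI)).
Qed.

Lemma eq_rect_int (R : realType) (f g : R[i] -> R[i]) (a b c d : R) :
  a <= b -> c <= d -> (forall z, frame a b c d z -> f z = g z) ->
  rect_int f a b c d = rect_int g a b c d.
Proof.
move=> ab cd /(frame_sides ab cd)[f1 f2 f3 f4].
by rewrite /rect_int (eq_cint f1) (eq_cint f2) (eq_cint f3) (eq_cint f4).
Qed.

Lemma rect_intB (R : realType) (f g : R[i] -> R[i]) (a b c d : R) :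
  a <= b -> c <= d -> continuous_frame f a b c d -> continuous_frame g a b c d ->
  rect_int (fun z => f z - g z) a b c d = rect_int f a b c d - rect_int g a b c d.
Proof.
move=> ab cd /(continuous_frame_sides ab cd)[f1 f2 f3 f4].
move=> /(continuous_frame_sides ab cd)[g1 g2 g3 g4].
by rewrite /rect_int !cintB//; ring.
Qed.

Lemma rect_intD (R : realType) (f g : R[i] -> R[i]) (a b c d : R) :
  a <= b -> c <= d -> continuous_frame f a b c d -> continuous_frame g a b c d ->
  rect_int (fun z => f z + g z) a b c d = rect_int f a b c d + rect_int g a b c d.
Proof.
move=> ab cd /(continuous_frame_sides ab cd)[f1 f2 f3 f4].
move=> /(continuous_frame_sides ab cd)[g1 g2 g3 g4].
by rewrite /rect_int !cintD//; ring.
Qed.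

Lemma rect_intZ (R : realType) (k : R[i]) (f : R[i] -> R[i]) (a b c d : R) :
  a <= b -> c <= d -> continuous_frame f a b c d ->
  rect_int (fun z => k * f z) a b c d = k * rect_int f a b c d.
Proof.
move=> ab cd /(continuous_frame_sides ab cd)[f1 f2 f3 f4].
by rewrite /rect_int !cintZ//; ring.
Qed.

Lemma cnorm_rect_int_le (R : realType) (f : R[i] -> R[i]) (a b c d M : R) :
  a <= b -> c <= d -> continuous_frame f a b c d ->
  (forall z, frame a b c d z -> cnorm (f z) <= M) ->
  cnorm (rect_int f a b c d) <= 4 * M * ((b - a) + (d - c)).
Proof.
move=> ab cd /(continuous_frame_sides ab cd)[f1 f2 f3 f4].
move=> /(frame_sides ab cd)[M1 M2 M3 M4].
have -> : 4 * M * ((b - a) + (d - c)) =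
    (2 * M * (b - a) + 2 * M * (b - a)) +
    (2 * M * (d - c) + 2 * M * (d - c)) by ring.
rewrite /rect_int; apply: le_trans (cnormD_le _ _) _; apply: lerD.
  by refine (le_trans (cnormB_le _ _) _); apply: lerD; exact: cnorm_cint_le.
rewrite Normc.normcM.
have -> : cnorm (Complex 0 1 : R[i]) = 1 by rewrite /= expr0n expr1n add0r sqrtr1.
rewrite mul1r.
by refine (le_trans (cnormB_le _ _) _); apply: lerD; exact: cnorm_cint_le.
Qed.

Lemma continuous_affine (R : realType) (k l z : R[i]) :
  {for z, continuous ((fun w => k + l * w) : R[i]^o -> R[i]^o)}.
Proof.
apply: (@differentiable_continuous R[i] R[i]^o R[i]^o).
apply/derivable1_diffP; apply: derivableD; first exact: derivable_cst.
by apply: derivableM; [exact: derivable_cst|exact: derivable_id].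
Qed.

(** The integrands on opposite sides differ by a constant: [l * i * (c - d)] for the horizontal pair
    and [l * (b - a)] for the vertical pair. After integration the two contributions cancel. *)
Lemma rect_int_affine (R : realType) (k l : R[i]) (a b c d : R) :
  a <= b -> c <= d -> rect_int (fun z => k + l * z) a b c d = 0.
Proof.
move=> ab cd.
have cf : continuous_frame (fun z => k + l * z) a b c d.
  by move=> z _; exact: continuous_affine.
have [f1 f2 f3 f4] := continuous_frame_sides ab cd cf.
rewrite /rect_int -!cintB//.
rewrite (@eq_cint _ a b _ (fun=> l * Complex 0 (c - d))); last first.
  move=> x _; rewrite opprD addrACA subrr add0r -mulrBr; congr (_ * _).
  by apply/eqP; rewrite eq_complex /= subrr !eqxx.
rewrite [X in _ + _ * X](@eq_cint _ c d _ (fun=> l * Complex (b - a) 0)); last first.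
  move=> x _; rewrite opprD addrACA subrr add0r -mulrBr; congr (_ * _).
  by apply/eqP; rewrite eq_complex /= subrr !eqxx.
rewrite !cint_cst//; case: l {cf f1 f2 f3 f4} => p q; simpc.
by apply/eqP; rewrite eq_complex /=; apply/andP; split; apply/eqP; ring.
Qed.

(** The side on the line through [m] is traversed once in each direction, so its two integrals
    cancel. *)
Lemma rect_int_splitx (R : realType) (f : R[i] -> R[i]) (a m b c d : R) :
  a <= m <= b -> c <= d -> continuous_frame f a b c d ->
  rect_int f a b c d = rect_int f a m c d + rect_int f m b c d.
Proof.
move=> amb cd; have ab : a <= b by case/andP: amb; exact: le_trans.
move=> /(continuous_frame_sides ab cd)[f1 f2 f3 f4].
by rewrite /rect_int (cint_split amb f1) (cint_split amb f2); ring.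
Qed.

Lemma rect_int_splity (R : realType) (f : R[i] -> R[i]) (a b c m d : R) :
  a <= b -> c <= m <= d -> continuous_frame f a b c d ->
  rect_int f a b c d = rect_int f a b c m + rect_int f a b m d.
Proof.
move=> ab cmd; have cd : c <= d by case/andP: cmd; exact: le_trans.
move=> /(continuous_frame_sides ab cd)[f1 f2 f3 f4].
by rewrite /rect_int (cint_split cmd f3) (cint_split cmd f4); ring.
Qed.

(** * Goursat's theorem by bisection *)

(** The supremum of the left ends works, because every right end is an upper bound of all left
    ends. *)
Lemma nested_itv (R : realType) (u v : nat -> R) :
  (forall n, u n <= u n.+1) -> (forall n, v n.+1 <= v n) ->
  (forall n, u n <= v n) -> exists x, forall n, u n <= x <= v n.
Proof.
move=> uS vS uv.
have um m n : (m <= n)%N -> u m <= u n.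
  by apply: (homo_leq (r := fun x y => x <= y)) => //; exact: le_trans.
have vm m n : (m <= n)%N -> v n <= v m.
  apply: (homo_leq (r := fun x y => y <= x)) => // x y z yx zy.
  exact: le_trans zy yx.
have uvmn m n : u m <= v n.
  case: (leqP m n) => mn; first exact: le_trans (um _ _ mn) (uv n).
  exact: le_trans (uv m) (vm _ _ (ltnW mn)).
exists (sup (range u)) => n; apply/andP; split.
  apply: ub_le_sup; last by exists n.
  by exists (v 0) => _ [m _ <-].
apply: ge_sup; first by exists (u 0); exists 0.
by move=> _ [m _ <-].
Qed.

Lemma half_expn_lt (R : realType) (e : R) : 0 < e ->
  exists n, (2^-1 : R) ^+ n < e.
Proof.
move=> e0; have h1 : `|2^-1 : R| < 1.
  by rewrite ger0_norm ?invr_ge0// invf_lt1// ltr1n.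
have /cvgrPdist_lt/(_ e e0)[N _ /(_ N (leqnn N))] := cvg_expr h1.
by rewrite /= sub0r normrN ger0_norm ?exprn_ge0 ?invr_ge0//; exists N.
Qed.

Lemma derivable_continuous (R : realType) (f : R[i] -> R[i]) (z : R[i]) :
  derivable (f : R[i]^o -> R[i]^o) z 1 ->
  {for z, continuous (f : R[i]^o -> R[i]^o)}.
Proof.
by move=> /(@derivable1_diffP R[i] R[i]^o)/(@differentiable_continuous R[i]).
Qed.

(** One vertical cut and a horizontal cut of each half write the integral as a sum over four
    quarters. If all four had modulus at most [e], the total could not exceed [e *+ 4]. *)
Lemma rect_int_quarter (R : realType) (f : R[i] -> R[i]) (x y h k e : R) :
  0 <= h -> 0 <= k ->
  (forall z, x <= complex.Re z <= x + (h + h) ->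
     y <= complex.Im z <= y + (k + k) ->
     {for z, continuous (f : R[i]^o -> R[i]^o)}) ->
  e *+ 4 < cnorm (rect_int f x (x + (h + h)) y (y + (k + k))) ->
  exists x' y', [/\ (x' == x) || (x' == x + h), (y' == y) || (y' == y + k) &
    e < cnorm (rect_int f x' (x' + h) y' (y' + k))].
Proof.
move=> h0 k0 fc big.
have cF a b c d : x <= a -> b <= x + (h + h) -> y <= c -> d <= y + (k + k) ->
    continuous_frame f a b c d.
  move=> xa bx yc dy z [/andP[za zb] /andP[zc zd] _]; apply: fc.
    by rewrite (le_trans xa za) (le_trans zb bx).
  by rewrite (le_trans yc zc) (le_trans zd dy).
have : e *+ 4 < cnorm (rect_int f x (x + h) y (y + k)) +
    cnorm (rect_int f x (x + h) (y + k) (y + k + k)) +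
    (cnorm (rect_int f (x + h) (x + h + h) y (y + k)) +
    cnorm (rect_int f (x + h) (x + h + h) (y + k) (y + k + k))).
  apply: lt_le_trans big _; rewrite !(addrA x) !(addrA y).
  rewrite (@rect_int_splitx _ f x (x + h)); first last.
  - by apply: cF; lra.
  - lra.
  - by apply/andP; split; lra.
  apply: le_trans (cnormD_le _ _) _; apply: lerD.
    rewrite (@rect_int_splity _ f x (x + h) y (y + k)); first exact: cnormD_le.
    - lra.
    - by apply/andP; split; lra.
    - by apply: cF; lra.
  rewrite (@rect_int_splity _ f (x + h) _ y (y + k)); first exact: cnormD_le.
  - lra.
  - by apply/andP; split; lra.
  - by apply: cF; lra.
have [E1 _|E1] := ltP e (cnorm (rect_int f x (x + h) y (y + k))).
  by exists x, y; rewrite !eqxx.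
have [E2 _|E2] := ltP e (cnorm (rect_int f x (x + h) (y + k) (y + k + k))).
  by exists x, (y + k); rewrite !eqxx orbT.
have [E3 _|E3] := ltP e (cnorm (rect_int f (x + h) (x + h + h) y (y + k))).
  by exists (x + h), y; rewrite !eqxx orbT.
have [E4 _|E4] := ltP e (cnorm (rect_int f (x + h) (x + h + h) (y + k) (y + k + k))).
  by exists (x + h), (y + k); rewrite !eqxx !orbT.
move: E1 E2 E3 E4; move: (cnorm _) (cnorm _) (cnorm _) (cnorm _) => A1 A2 A3 A4.
by rewrite -mulr_natr; lra.
Qed.

(* Near a point of differentiability, [f] is affine up to [o(size)] and affine
   functions have zero boundary integral. *)
Lemma rect_int_small_square (R : realType) (f : R[i] -> R[i]) (z0 : R[i]) (p q e : R) :
  0 <= p -> 0 <= q -> 0 < e -> derivable (f : R[i]^o -> R[i]^o) z0 1 ->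
  exists2 t0 : R, 0 < t0 & forall x y t, 0 < t < t0 ->
    x <= complex.Re z0 <= x + p * t -> y <= complex.Im z0 <= y + q * t ->
    continuous_frame f x (x + p * t) y (y + q * t) ->
    cnorm (rect_int f x (x + p * t) y (y + q * t)) <= e * t ^+ 2.
Proof.
move=> p0 q0 e0 /derivable_cball[l fl].
(* Boundary points lie within [(p + q) * t] of [z0] and the side lengths add up to the same
   quantity, so the tolerance is divided by [4 * (p + q + 1) ^+ 2]. The summand 1 keeps this divisor
   positive when [p = q = 0]. *)
have s0 : 0 < p + q + 1 by lra.
have e'0 : 0 < e / (4 * (p + q + 1) ^+ 2) by rewrite divr_gt0// mulr_gt0// exprn_gt0.
have [d d0 Hd] := fl _ e'0.
exists (d / (p + q + 1)); first exact: divr_gt0.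
move=> x y t /andP[t0 td] xz yz cf.
have pt0 : 0 <= p * t by rewrite mulr_ge0// ltW.
have qt0 : 0 <= q * t by rewrite mulr_ge0// ltW.
have xp : x <= x + p * t by rewrite lerDl.
have yq : y <= y + q * t by rewrite lerDl.
pose g z := (f z0 - l * z0) + l * z.
have cg : continuous_frame g x (x + p * t) y (y + q * t).
  by move=> z _; exact: continuous_affine.
have -> : rect_int f x (x + p * t) y (y + q * t) =
    rect_int (fun z => f z - g z) x (x + p * t) y (y + q * t).
  by rewrite rect_intB// /g rect_int_affine// subr0.
have fgz z : frame x (x + p * t) y (y + q * t) z ->
    cnorm (f z - g z) <= e / (4 * (p + q + 1) ^+ 2) * ((p + q + 1) * t).
  move=> [zx zy _].
  have zz0 : cnorm (z - z0) <= (p + q) * t.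
    apply: le_trans (cnorm_le_ReIm _) _; rewrite !raddfB /= mulrDl.
    by apply: lerD; rewrite ler_norml; apply/andP; split; lra.
  have -> : f z - g z = f z - f z0 - l * (z - z0) by rewrite /g; ring.
  apply: le_trans (Hd _ _) _.
    apply: le_lt_trans zz0 _; move: td; rewrite ltr_pdivlMr// => td.
    by apply: le_lt_trans td; rewrite mulrC ler_wpM2l ?ltW//; lra.
  rewrite ler_wpM2l//; first exact: ltW.
  by apply: le_trans zz0 _; rewrite ler_wpM2r ?ltW//; lra.
have cfg : continuous_frame (fun z => f z - g z) x (x + p * t) y (y + q * t).
  by move=> z Fz; apply: continuousB; [exact: cf|exact: cg].
apply: le_trans (cnorm_rect_int_le xp yq cfg fgz) _.
have -> : x + p * t - x + (y + q * t - y) = (p + q) * t by ring.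
have -> : 4 * (e / (4 * (p + q + 1) ^+ 2) * ((p + q + 1) * t)) * ((p + q) * t) =
  e * t ^+ 2 * ((p + q) / (p + q + 1)) by field; rewrite gt_eqF.
rewrite ler_piMr ?mulr_ge0 ?exprn_ge0 ?(ltW e0) ?(ltW t0)//.
by rewrite ler_pdivrMr// mul1r lerDl.
Qed.

(** If the integral were nonzero, quartering would give nested rectangles of scale [t n] whose
    integrals exceed [e * t n ^+ 2] in modulus. Differentiability at their common point contradicts
    this through [rect_int_small_square]. *)
Lemma goursat (R : realType) (f : R[i] -> R[i]) (a b c d : R) :
  a <= b -> c <= d ->
  (forall z, a <= complex.Re z <= b -> c <= complex.Im z <= d ->
     derivable (f : R[i]^o -> R[i]^o) z 1) ->
  rect_int f a b c d = 0.
Proof.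
move=> ab cd fD; apply: contrapT => /eqP ri0.
pose t n : R := 2^-1 ^+ n.
have tE n : t n = t n.+1 + t n.+1 by rewrite /t exprS; field.
have t0 n : 0 < t n by rewrite exprn_gt0// invr_gt0.
pose p n := (b - a) * t n; pose q n := (d - c) * t n.
have p0 n : 0 <= p n by rewrite mulr_ge0 ?subr_ge0// ltW.
have q0 n : 0 <= q n by rewrite mulr_ge0 ?subr_ge0// ltW.
have pE n : p n = p n.+1 + p n.+1 by rewrite /p -mulrDr -tE.
have qE n : q n = q n.+1 + q n.+1 by rewrite /q -mulrDr -tE.
(* Halving makes the strict inequality [bad] true of the initial rectangle. *)
pose e := cnorm (rect_int f a b c d) / 2.
have e0 : 0 < e by rewrite divr_gt0// cnorm_gt0.
pose inR n (s : R * R) :=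
  [/\ a <= s.1, s.1 + p n <= b, c <= s.2 & s.2 + q n <= d].
pose bad n (s : R * R) :=
  e * t n ^+ 2 < cnorm (rect_int f s.1 (s.1 + p n) s.2 (s.2 + q n)).
(* A state is a level together with a lower left corner. The implication makes a successor exist for
   every state, good or not, so that choice yields a function to iterate. *)
pose nx (s s' : nat * (R * R)) := inR s.1 s.2 /\ bad s.1 s.2 ->
  [/\ s'.1 = s.1.+1, inR s'.1 s'.2 /\ bad s'.1 s'.2,
      s.2.1 <= s'.2.1 /\ s'.2.1 + p s'.1 <= s.2.1 + p s.1 &
      s.2.2 <= s'.2.2 /\ s'.2.2 + q s'.1 <= s.2.2 + q s.1].
have /choice[F nxF] : forall s, exists s', nx s s'.
  move=> [n [x y]]; rewrite /nx /inR /bad /=.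
  have [H|H] := pselect (inR n (x, y) /\ bad n (x, y)); last first.
    by exists (n, (x, y)) => /H.
  case: H => -[/= ax xb cy yd] B.
  have := @rect_int_quarter _ f x y (p n.+1) (q n.+1) (e * t n.+1 ^+ 2) (p0 _) (q0 _).
  rewrite -pE -qE => -[z /andP[z1 z2] /andP[z3 z4]||x' [y' [xx' yy' bad']]].
  - by apply: derivable_continuous; apply: fD; lra.
  - move: B; rewrite /bad /= {1}tE; congr (_ < _); ring.
  exists (n.+1, (x', y')) => _; rewrite /inR /bad /=; rewrite !(pE n) !(qE n).
  have := p0 n.+1; have := q0 n.+1; move: xb yd bad' xx' yy'; rewrite (pE n) (qE n).
  clear -ax cy; move: (p n.+1) (q n.+1) => h k xb yd bad' xx' yy' k0 h0.
  by case/orP: xx' => /eqP ?; case/orP: yy' => /eqP ?; subst x' y';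
    split=> //; split=> //; try split; lra.
pose S n := iter n F (0%N, (a, c)).
have S0 : inR 0%N (a, c) /\ bad 0%N (a, c).
  have aE : a + p 0 = b by rewrite /p /t expr0 mulr1 addrC subrK.
  have cE : c + q 0 = d by rewrite /q /t expr0 mulr1 addrC subrK.
  rewrite /inR /bad /= aE cE; split; first by split; rewrite ?lexx.
  rewrite /t expr0 expr1n mulr1 /e ltr_pdivrMr// ltr_pMr ?ltr1n//.
  exact: cnorm_gt0.
have SP n : (S n).1 = n /\ (inR n (S n).2 /\ bad n (S n).2).
  elim: n => [//|n [Sn IH]].
  by have := nxF (S n); rewrite /nx Sn => /(_ IH)[/= -> ].
have SS n : [/\ (S n).2.1 <= (S n.+1).2.1,
    (S n.+1).2.1 + p n.+1 <= (S n).2.1 + p n,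
    (S n).2.2 <= (S n.+1).2.2 &
    (S n.+1).2.2 + q n.+1 <= (S n).2.2 + q n].
  have [Sn IH] := SP n; have [Sn1 _] := SP n.+1.
  have := nxF (S n); rewrite /nx -/(S n.+1) Sn Sn1.
  by move=> /(_ IH)[_ _ [? ?] [? ?]].
have [|||X XP] := @nested_itv _ (fun n => (S n).2.1) (fun n => (S n).2.1 + p n).
- by move=> n; have [] := SS n.
- by move=> n; have [] := SS n.
- by move=> n; rewrite lerDl.
have [|||Y YP] := @nested_itv _ (fun n => (S n).2.2) (fun n => (S n).2.2 + q n).
- by move=> n; have [] := SS n.
- by move=> n; have [] := SS n.
- by move=> n; rewrite lerDl.
(* The common point lies in the rectangle of level 0, which is the original one. *)
have XYD : derivable (f : R[i]^o -> R[i]^o) (Complex X Y) 1.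
  have [_ [[/= ? ? ? ?] _]] := SP 0%N; have := XP 0%N; have := YP 0%N.
  by move=> /= ? ?; apply: fD => /=; lra.
have ba0 : 0 <= b - a by rewrite subr_ge0.
have dc0 : 0 <= d - c by rewrite subr_ge0.
have [t1 t10 small] := rect_int_small_square ba0 dc0 e0 XYD.
have [n nt1] := half_expn_lt t10.
have [_ [[ax xb cy yd]]] := SP n; rewrite /bad ltNge => /negP; apply.
apply: small; [by rewrite t0|exact: XP|exact: YP|].
move=> z [/andP[z1 z2] /andP[z3 z4] _]; apply: derivable_continuous.
by apply: fD; apply/andP; split; [exact: le_trans z1|exact: le_trans xb|
  exact: le_trans z3|exact: le_trans yd].
Qed.

(** * Cauchy's formula on a rectangle *)

(** By [goursat] the integral equals that over an arbitrarily small square around [w]. There [h] is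
    bounded by [M] while the perimeter tends to 0. *)
Lemma rect_int_removable (R : realType) (h : R[i] -> R[i]) (w : R[i])
    (a b c d M d0 : R) :
  a < complex.Re w < b -> c < complex.Im w < d -> 0 < M -> 0 < d0 ->
  (forall z, z != w -> a <= complex.Re z <= b -> c <= complex.Im z <= d ->
     derivable (h : R[i]^o -> R[i]^o) z 1) ->
  (forall z, z != w -> cnorm (z - w) < d0 -> cnorm (h z) <= M) ->
  rect_int h a b c d = 0.
Proof.
case: w => u v /= /andP[au ub] /andP[cv vd] M0 d00 hD hM.
apply: contrapT => /eqP /cnorm_gt0; set A := cnorm _ => A0.
(* Here [t] is half the side of the small square. The first four bounds keep it inside the
   rectangle, [d0 / 2] keeps it where [h] is bounded, and [A / (16 * M)] contradicts the boundary
   estimate [16 * M * t]. *)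
have [t t0 [[t1 t2 t3 t4] t5 t6]] : exists2 t, 0 < t & [/\
    [/\ t < u - a, t < b - u, t < v - c & t < d - v], t < d0 / 2 &
    t < A / (16 * M)].
  exists (Num.min (Num.min (u - a) (b - u)) (Num.min (Num.min (v - c) (d - v))
    (Num.min (d0 / 2) (A / (16 * M)))) / 2); set r := Num.min _ _.
    by rewrite divr_gt0// !lt_min !subr_gt0 au ub cv vd !divr_gt0// mulr_gt0.
  have : r / 2 < r.
    rewrite ltr_pdivrMr// ltr_pMr ?ltr1n//.
    by rewrite !lt_min !subr_gt0 au ub cv vd !divr_gt0// mulr_gt0.
  by rewrite {2}/r !lt_min => /andP[/andP[-> ->] /andP[/andP[-> ->] /andP[-> ->]]].
have cF p q p' q' : a <= p -> q <= b -> c <= p' -> q' <= d ->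
    (forall z, frame p q p' q' z -> z != Complex u v) ->
    continuous_frame h p q p' q'.
  move=> ap qb cp qd zN z Fz; apply: derivable_continuous.
  have [/andP[z1 z2] /andP[z3 z4] _] := Fz.
  by apply: hD; [exact: zN|apply/andP; split; [exact: le_trans z1|exact: le_trans qb]
   |apply/andP; split; [exact: le_trans z3|exact: le_trans qd]].
(* A closed subrectangle lying strictly to one side of [w] avoids it, so [goursat] applies. *)
have G p q p' q' : a <= p -> p <= q -> q <= b -> c <= p' -> p' <= q' -> q' <= d ->
    [|| q < u, u < p, q' < v | v < p'] -> rect_int h p q p' q' = 0.
  move=> ap pq qb cp pq' qd out; apply: goursat => // -[x y] /= /andP[z1 z2] /andP[z3 z4].
  apply: hD => /=.
  - rewrite eq_complex /=; apply/negP => /andP[/eqP ? /eqP ?]; subst x y.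
    by move: out; rewrite !ltNge z1 z2 z3 z4.
  - by rewrite (le_trans ap z1) (le_trans z2 qb).
  - by rewrite (le_trans cp z3) (le_trans z4 qd).
have NF p q p' q' : p != u -> q != u -> p' != v -> q' != v ->
    forall z, frame p q p' q' z -> z != Complex u v.
  move=> pu qu pv qv [x y] [/= _ _ h1]; rewrite eq_complex /=.
  apply/negP => /andP[/eqP ? /eqP ?]; subst x y; move: h1.
  by rewrite ![u == _]eq_sym ![v == _]eq_sym (negbTE pu) (negbTE qu) (negbTE pv)
    (negbTE qv).
have NF' p q p' q' : p < u -> u < q -> p' < v -> v < q' ->
    forall z, frame p q p' q' z -> z != Complex u v.
  by move=> pu uq pv vq; apply: NF;
    rewrite ?(lt_eqF pu) ?(gt_eqF uq) ?(lt_eqF pv) ?(gt_eqF vq).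
have l1 : a <= u - t by rewrite lerBrDr addrC -lerBrDr ltW.
have l2 : u - t < u by rewrite ltrBlDr ltrDl.
have l3 : u < u + t by rewrite ltrDl.
have l4 : u + t <= b by rewrite addrC -lerBrDr ltW.
have m1 : c <= v - t by rewrite lerBrDr addrC -lerBrDr ltW.
have m2 : v - t < v by rewrite ltrBlDr ltrDl.
have m3 : v < v + t by rewrite ltrDl.
have m4 : v + t <= d by rewrite addrC -lerBrDr ltW.
have cd := lt_trans cv vd.
have l23 := lt_trans l2 l3; have m23 := lt_trans m2 m3.
(* Four cuts remove the strips to the left, to the right, below and above the small square; each
   strip avoids [w]. *)
have E : rect_int h a b c d = rect_int h (u - t) (u + t) (v - t) (v + t).
  rewrite (@rect_int_splitx _ h a (u - t) b c d); first last.
  - by apply: cF => //; exact: NF'.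
  - exact: ltW.
  - by rewrite l1 /= (le_trans (ltW l2))// ltW.
  rewrite (G a (u - t)) ?lexx ?l2 ?(ltW cd)//; last by lra.
  rewrite add0r (@rect_int_splitx _ h (u - t) (u + t) b c d); first last.
  - by apply: cF => //; exact: NF'.
  - exact: ltW.
  - by rewrite l4 (ltW l23).
  rewrite (G (u + t) b) ?lexx ?l3 ?orbT ?(ltW cd)//; last by lra.
  rewrite addr0 (@rect_int_splity _ h _ _ c (v - t) d); first last.
  - by apply: cF => //; exact: NF'.
  - by rewrite m1 /= (le_trans (ltW m2))// ltW.
  - exact: ltW.
  rewrite (G (u - t) (u + t) c (v - t)) ?lexx ?m2 ?orbT ?(ltW l23)//; last by lra.
  rewrite add0r (@rect_int_splity _ h _ _ (v - t) (v + t) d); first last.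
  - by apply: cF => //; exact: NF'.
  - by rewrite m4 (ltW m23).
  - exact: ltW.
  by rewrite (G (u - t) (u + t) (v + t) d) ?lexx ?m3 ?orbT ?addr0 ?(ltW l23)//; lra.
have : A <= 4 * M * ((u + t - (u - t)) + (v + t - (v - t))).
  rewrite /A E; apply: cnorm_rect_int_le; [exact: ltW|exact: ltW| |].
    by apply: cF => //; exact: NF'.
  move=> z Fz; apply: hM; first exact: (NF' _ _ _ _ l2 l3 m2 m3 _ Fz).
  have [/andP[z1 z2] /andP[z3 z4] _] := Fz.
  apply: le_lt_trans (cnorm_le_ReIm _) _; rewrite !raddfB /=.
  apply: (@le_lt_trans _ _ (t + t)); last by lra.
  by apply: lerD; rewrite ler_norml; apply/andP; split; lra.
have -> : 4 * M * ((u + t - (u - t)) + (v + t - (v - t))) = t * (16 * M) by ring.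
by move: t6; rewrite ltr_pdivlMr ?mulr_gt0// => /lt_le_trans H /H; rewrite ltxx.
Qed.

Lemma derivable_quot (R : realType) (f g : R[i] -> R[i]) (z : R[i]) : g z != 0 ->
  derivable (f : R[i]^o -> R[i]^o) z 1 -> derivable (g : R[i]^o -> R[i]^o) z 1 ->
  derivable ((fun z => f z / g z) : R[i]^o -> R[i]^o) z 1.
Proof.
move=> gz fD gD.
exact: (@derivableM R[i] R[i]^o f (fun z => (g z)^-1) z 1 fD
  (@derivableV R[i] R[i]^o g z 1 gz gD)).
Qed.

Lemma derivable_subr (R : realType) (w z : R[i]) :
  derivable ((fun z => z - w) : R[i]^o -> R[i]^o) z 1.
Proof. by apply: derivableB; [exact: derivable_id|exact: derivable_cst]. Qed.

Lemma continuous_inv_subr (R : realType) (w z : R[i]) : z != w ->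
  {for z, continuous ((fun z => (z - w)^-1) : R[i]^o -> R[i]^o)}.
Proof.
move=> zw; apply: derivable_continuous; apply: derivableV.
  by rewrite subr_eq0.
exact: derivable_subr.
Qed.

Lemma frame_neq (R : realType) (w z : R[i]) (a b c d : R) :
  a < complex.Re w < b -> c < complex.Im w < d -> frame a b c d z -> z != w.
Proof.
move=> /andP[au ub] /andP[cv vd] [_ _ zF]; apply/negP => /eqP zw; move: zF.
by rewrite zw (gt_eqF au) (lt_eqF ub) (gt_eqF cv) (lt_eqF vd).
Qed.

(* The last factor equals [2 i pi]; only its non-vanishing is needed. *)
Lemma cauchy_formula (R : realType) (f : R[i] -> R[i]) (w : R[i]) (a b c d : R) :
  a < complex.Re w < b -> c < complex.Im w < d ->
  (forall z, a <= complex.Re z <= b -> c <= complex.Im z <= d ->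
     derivable (f : R[i]^o -> R[i]^o) z 1) ->
  rect_int (fun z => f z / (z - w)) a b c d =
  f w * rect_int (fun z => (z - w)^-1) a b c d.
Proof.
move=> wab wcd fD.
have [wa wb] := andP wab; have [wc wd] := andP wcd.
have ab := ltW (lt_trans wa wb); have cd := ltW (lt_trans wc wd).
have ci : continuous_frame (fun z => (z - w)^-1) a b c d.
  by move=> z Fz; apply: continuous_inv_subr; exact: frame_neq Fz.
have cq : continuous_frame (fun z => f z / (z - w)) a b c d.
  move=> z Fz; apply: derivable_continuous; have [z1 z2 _] := Fz.
  apply: derivable_quot; [|exact: fD|exact: derivable_subr].
  by rewrite subr_eq0; exact: frame_neq Fz.
have ck : continuous_frame (fun z => f w * (z - w)^-1) a b c d.
  move=> z Fz; apply: continuousM; [exact: cst_continuous|exact: ci].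
(* The difference of the two sides is the integral of the difference quotient of [f] at [w], whose
   singularity is removable. *)
apply/eqP; rewrite -subr_eq0 -rect_intZ// -rect_intB//; apply/eqP.
have wF : derivable (f : R[i]^o -> R[i]^o) w 1.
  by apply: fD; rewrite ?(ltW wa) ?(ltW wb) ?(ltW wc) ?(ltW wd).
(* Tolerance 1 in the definition of the derivative [l] bounds the difference quotient near [w] by
   [1 + cnorm l]. *)
have [l /(_ 1 ltr01)[d0 d00 fl]] := derivable_cball wF.
have M0 : 0 < 1 + cnorm l by rewrite ltr_pwDl// cnorm_ge0.
apply: (rect_int_removable wab wcd M0 d00) => z zw.
  move=> z1 z2; apply: derivableB.
    by apply: derivable_quot; [rewrite subr_eq0|exact: fD|exact: derivable_subr].
  apply: derivableM; first exact: derivable_cst.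
  by apply: derivableV; [rewrite subr_eq0|exact: derivable_subr].
move=> /fl; rewrite mul1r => H.
have zw0 : z - w != 0 by rewrite subr_eq0.
have -> : f z / (z - w) - f w / (z - w) =
  (f z - f w - l * (z - w)) / (z - w) + l by field.
apply: le_trans (cnormD_le _ _) _; rewrite lerD2r Normc.normcM Normc.normcV.
by rewrite ler_pdivrMr ?mul1r// cnorm_gt0.
Qed.

(** The argument of [z - w] increases along each positively oriented side, so every side contributes
    a positive imaginary part. *)
Lemma rect_int_inv_subr_neq0 (R : realType) (w : R[i]) (a b c d : R) :
  a < complex.Re w < b -> c < complex.Im w < d ->
  rect_int (fun z => (z - w)^-1) a b c d != 0.
Proof.
move=> wab wcd; have [wa wb] := andP wab; have [wc wd] := andP wcd.
have ab := lt_trans wa wb; have cd := lt_trans wc wd.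
have ci : continuous_frame (fun z => (z - w)^-1) a b c d.
  by move=> z Fz; apply: continuous_inv_subr; exact: frame_neq Fz.
have [f1 f2 f3 f4] := continuous_frame_sides (ltW ab) (ltW cd) ci.
suff : 0 < complex.Im (rect_int (fun z => (z - w)^-1) a b c d).
  by apply: contraTneq => ->; rewrite ltxx.
have den (p q : R) : (p != 0) || (q != 0) -> 0 < p ^+ 2 + q ^+ 2.
  move=> pq; rewrite lt_neqAle eq_sym paddr_eq0 ?sqr_ge0// !sqrf_eq0 negb_and.
  by rewrite pq addr_ge0 ?sqr_ge0.
have cZ (p q : R) k u : continuous_itv p q u ->
    continuous_itv p q (fun x => k * u x : R[i]).
  by move=> cu x xpq; apply: continuousM; [exact: cst_continuous|exact: cu].
(* Signs and factors [i] are moved inside the integrals, so that each of the four integrands has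
   positive imaginary part pointwise. *)
have -> : rect_int (fun z => (z - w)^-1) a b c d =
  (cint a b (fun x => (Complex x c - w)^-1) +
   cint a b (fun x => -1 * (Complex x d - w)^-1)) +
  (cint c d (fun y => Complex 0 1 * (Complex b y - w)^-1) +
   cint c d (fun y => - Complex 0 1 * (Complex a y - w)^-1)).
  by rewrite !cintZ// /rect_int; ring.
have ImD (z1 z2 : R[i]) : complex.Im (z1 + z2) = complex.Im z1 + complex.Im z2.
  exact: raddfD.
rewrite !ImD; apply: addr_gt0; apply: addr_gt0.
- apply: Im_cint_gt0; [exact: ab|exact: f1|move=> t _].
  case: w wa wb wc wd {wab wcd ci f1 f2 f3 f4} => u v /= wa wb wc wd.
  simpc => /=; rewrite -mulNr opprB divr_gt0 ?subr_gt0 ?den//.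
  by rewrite !subr_eq0 (lt_eqF wc) orbT.
- apply: Im_cint_gt0; [exact: ab|exact: (cZ _ _ _ _ f2)|move=> t _].
  case: w wa wb wc wd {wab wcd ci f1 f2 f3 f4} => u v /= wa wb wc wd.
  simpc => /=; rewrite divr_gt0 ?subr_gt0 ?den//.
  by rewrite !subr_eq0 (gt_eqF wd) orbT.
- apply: Im_cint_gt0; [exact: cd|exact: (cZ _ _ _ _ f4)|move=> t _].
  case: w wa wb wc wd {wab wcd ci f1 f2 f3 f4} => u v /= wa wb wc wd.
  simpc => /=; rewrite divr_gt0 ?subr_gt0 ?den//.
  by rewrite !subr_eq0 (gt_eqF wb).
- apply: Im_cint_gt0; [exact: cd|exact: (cZ _ _ _ _ f3)|move=> t _].
  case: w wa wb wc wd {wab wcd ci f1 f2 f3 f4} => u v /= wa wb wc wd.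
  simpc => /=; rewrite -mulNr opprB divr_gt0 ?subr_gt0 ?den//.
  by rewrite !subr_eq0 (lt_eqF wa).
Qed.

(** * Taylor remainders of the Cauchy integral, and accumulating zeros at the centre of a square *)

Lemma within_itv_bounded (R : realType) (a b : R) (g : R -> R) :
  a <= b -> {within `[a, b], continuous (g : R -> R^o)} ->
  exists2 K, 0 <= K & forall x, a <= x <= b -> `|g x| <= K.
Proof.
move=> ab cg; have [c _ cM] := EVT_max ab cg; have [d _ dm] := EVT_min ab cg.
exists (`|g c| + `|g d|) => [|x xab]; first by rewrite addr_ge0.
have xI : x \in `[a, b] by rewrite in_itv.
rewrite ler_norml; apply/andP; split.
  rewrite lerNl; apply: (@le_trans _ _ (- g d)); first by rewrite lerN2 dm.
  by rewrite (le_trans (ler_norm _))// normrN lerDr.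
by rewrite (le_trans (cM _ xI))// (le_trans (ler_norm _))// lerDl.
Qed.

Lemma continuous_itv_bounded (R : realType) (a b : R) (u : R -> R[i]) :
  a <= b -> continuous_itv a b u ->
  exists2 K, 0 <= K & forall x, a <= x <= b -> cnorm (u x) <= K.
Proof.
move=> ab /continuous_itv_within[cR cI].
have [K1 K10 HK1] := within_itv_bounded ab cR.
have [K2 K20 HK2] := within_itv_bounded ab cI.
exists (K1 + K2) => [|x xab]; first exact: addr_ge0.
by rewrite (le_trans (cnorm_le_ReIm _))// lerD ?HK1 ?HK2.
Qed.

Lemma continuous_frame_bounded (R : realType) (f : R[i] -> R[i]) (a b c d : R) :
  a <= b -> c <= d -> continuous_frame f a b c d ->
  exists2 K, 0 < K & forall z, frame a b c d z -> cnorm (f z) <= K.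
Proof.
move=> ab cd /(continuous_frame_sides ab cd)[f1 f2 f3 f4].
have [K1 K10 H1] := continuous_itv_bounded ab f1.
have [K2 K20 H2] := continuous_itv_bounded ab f2.
have [K3 K30 H3] := continuous_itv_bounded cd f3.
have [K4 K40 H4] := continuous_itv_bounded cd f4.
exists (K1 + K2 + K3 + K4 + 1); first by rewrite ltr_wpDl// !addr_ge0.
move=> [x y] [/= xab ycd /or4P[]/eqP E]; subst.
- by apply: le_trans (H3 _ ycd) _; clear -K10 K20 K40; lra.
- by apply: le_trans (H4 _ ycd) _; clear -K10 K20 K30; lra.
- by apply: le_trans (H1 _ xab) _; clear -K20 K30 K40; lra.
- by apply: le_trans (H2 _ xab) _; clear -K10 K30 K40; lra.
Qed.

Lemma frame_square_ge (R : realType) (r : R) (z : R[i]) :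
  0 <= r -> frame (- r) r (- r) r z -> r <= cnorm z.
Proof.
move=> r0 [_ _ zF]; have nr : `|r| = r by exact: ger0_norm.
case/or4P: zF => /eqP E.
- by apply: le_trans (normRe_le z); rewrite E normrN nr.
- by apply: le_trans (normRe_le z); rewrite E nr.
- by apply: le_trans (normIm_le z); rewrite E normrN nr.
- by apply: le_trans (normIm_le z); rewrite E nr.
Qed.

Lemma derivable_expn (R : realType) (n : nat) (z : R[i]) :
  derivable ((fun z => z ^+ n) : R[i]^o -> R[i]^o) z 1.
Proof.
elim: n => [|n IH]; first exact: derivable_cst.
rewrite (_ : (fun z => _) = (fun z : R[i] => z * z ^+ n)); last first.
  by apply/funext => x; rewrite exprS.
apply: (@derivableM R[i] R[i]^o (fun z => z) (fun z => z ^+ n)); last exact: IH.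
exact: derivable_id.
Qed.

Definition derivable_square (R : realType) (f : R[i] -> R[i]) (r : R) :=
  forall z, - r <= complex.Re z <= r -> - r <= complex.Im z <= r ->
    derivable (f : R[i]^o -> R[i]^o) z 1.

(* [cauchy_rem f r n] is the [n]-th Taylor remainder of [cauchy_rem f r 0] divided
   by [w ^+ n], and its value at [0] is the [n]-th Taylor coefficient. *)
Definition cauchy_rem (R : realType) (f : R[i] -> R[i]) (r : R) (n : nat)
  (w : R[i]) : R[i] := rect_int (fun z => f z / (z ^+ n * (z - w))) (- r) r (- r) r.

Lemma cauchy_rem_continuous (R : realType) (f : R[i] -> R[i]) (r : R) n w :
  0 < r -> derivable_square f r -> cnorm w < r ->
  continuous_frame (fun z => f z / (z ^+ n * (z - w))) (- r) r (- r) r.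
Proof.
move=> r0 fD wr z Fz; have [z1 z2 _] := Fz; have rz := frame_square_ge (ltW r0) Fz.
apply: derivable_continuous; apply: derivable_quot; last 2 first.
- exact: fD.
- apply: (@derivableM R[i] R[i]^o (fun z => z ^+ n) (fun z => z - w)).
    exact: derivable_expn.
  exact: derivable_subr.
rewrite mulf_neq0 ?expf_neq0//.
  by apply: contraTneq rz => ->; rewrite Normc.normc0 -ltNge.
by rewrite subr_eq0; apply: contraTneq rz => ->; rewrite -ltNge.
Qed.

(** One step of the geometric expansion: [1 / (z - w) = 1 / z + w / (z * (z - w))], multiplied by
    [f z / z ^+ n] and integrated. *)
Lemma cauchy_rem_rec (R : realType) (f : R[i] -> R[i]) (r : R) n w :
  0 < r -> derivable_square f r -> cnorm w < r ->
  cauchy_rem f r n w = cauchy_rem f r n 0 + w * cauchy_rem f r n.+1 w.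
Proof.
move=> r0 fD wr; have rr : - r <= r by rewrite ge0_cp// ltW.
have c0 : cnorm (0 : R[i]) < r by rewrite Normc.normc0.
have cn1 := cauchy_rem_continuous (n := n.+1) r0 fD wr.
have cn := cauchy_rem_continuous (n := n) r0 fD c0.
have cw : continuous_frame (fun z => w * (f z / (z ^+ n.+1 * (z - w)))) (- r) r (- r) r.
  by move=> z Fz; apply: continuousM; [exact: cst_continuous|exact: cn1].
rewrite /cauchy_rem -(rect_intZ w rr rr cn1) -(rect_intD rr rr cn cw).
apply: (eq_rect_int rr rr) => z Fz; have rz := frame_square_ge (ltW r0) Fz.
have z0 : z != 0 by apply: contraTneq rz => ->; rewrite -ltNge.
have zw : z - w != 0.
  by rewrite subr_eq0; apply: contraTneq rz => ->; rewrite -ltNge.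
have zn0 : z ^+ n != 0 by rewrite expf_neq0.
by rewrite exprS; field; rewrite z0 zw zn0.
Qed.

(** On the boundary the modulus of [z] is at least [r], and that of [z - w] is at least [r / 2]. The
    constant is uniform in [n] and [w], as the later passage to large [n] requires. *)
Lemma cauchy_rem_le (R : realType) (f : R[i] -> R[i]) (r : R) :
  0 < r -> derivable_square f r -> exists2 K, 0 < K &
  forall n w, cnorm w <= r / 2 -> cnorm (cauchy_rem f r n w) <= K / r ^+ n.
Proof.
move=> r0 fD; have rr : - r <= r by rewrite ge0_cp// ltW.
have cf : continuous_frame f (- r) r (- r) r.
  by move=> z [z1 z2 _]; apply: derivable_continuous; exact: fD.
have [K K0 HK] := continuous_frame_bounded rr rr cf.
exists (4 * (K / (r / 2)) * (r - - r + (r - - r))) => [|n w wr].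
  rewrite opprK; apply: mulr_gt0; last by rewrite !addr_gt0.
  by apply: mulr_gt0 => //; rewrite !divr_gt0.
have wr1 : cnorm w < r by rewrite (le_lt_trans wr)// ltr_pdivrMr// ltr_pMr ?ltr1n.
have -> : 4 * (K / (r / 2)) * (r - - r + (r - - r)) / r ^+ n =
    4 * (K / (r ^+ n * (r / 2))) * (r - - r + (r - - r)).
  by field; rewrite ?(gt_eqF (exprn_gt0 _ _)) ?(gt_eqF r0).
apply: (cnorm_rect_int_le rr rr (cauchy_rem_continuous (n := n) r0 fD wr1)).
move=> z Fz; have rz := frame_square_ge (ltW r0) Fz.
have zw : r / 2 <= cnorm (z - w).
  rewrite -(lerD2r (r / 2)) -splitr (le_trans rz)//.
  by rewrite -{1}(subrK w z) (le_trans (cnormD_le _ _))// lerD2l.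
have r20 : 0 < r / 2 by rewrite divr_gt0.
rewrite Normc.normcM Normc.normcV Normc.normcM.
have -> : cnorm (z ^+ n) = cnorm z ^+ n.
  elim: n => [|n IH]; first by rewrite !expr0 Normc.normc1.
  by rewrite !exprS Normc.normcM IH.
apply: ler_pM; rewrite ?cnorm_ge0 ?invr_ge0 ?mulr_ge0 ?exprn_ge0 ?cnorm_ge0 ?HK//.
rewrite lef_pV2 ?posrE ?mulr_gt0 ?exprn_gt0//.
- by rewrite ler_pM ?exprn_ge0 ?lerXn2r ?nnegrE ?cnorm_ge0 ?(ltW r0) ?(ltW r20).
- exact: lt_le_trans rz.
- exact: lt_le_trans zw.
Qed.

(** All Taylor coefficients of [cauchy_rem f r 0] vanish by induction, so this function equals
    [w ^+ n] times its [n]-th remainder for every [n] and is therefore 0. It is also [f w] times a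
    nonzero integral. *)
Lemma identity_square0 (R : realType) (f : R[i] -> R[i]) (r : R) :
  0 < r -> derivable_square f r ->
  (forall e, 0 < e -> exists w, [/\ w != 0, cnorm w < e & f w = 0]) ->
  forall w, cnorm w < r / 2 -> f w = 0.
Proof.
move=> r0 fD zeros; have [K K0 HK] := cauchy_rem_le r0 fD.
have r20 : 0 < r / 2 by rewrite divr_gt0.
have r2r : r / 2 < r by rewrite ltr_pdivrMr// ltr_pMr ?ltr1n.
have inS w : cnorm w < r -> - r < complex.Re w < r /\ - r < complex.Im w < r.
  move=> wr; rewrite -!ltr_norml.
  by rewrite (le_lt_trans (normRe_le w))// (le_lt_trans (normIm_le w)).
have rem0 w : cnorm w < r -> cauchy_rem f r 0 w =
    f w * rect_int (fun z => (z - w)^-1) (- r) r (- r) r.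
  move=> /inS[w1 w2].
  have E : (fun z => f z / (z ^+ 0 * (z - w))) = (fun z => f z / (z - w)).
    by apply/funext => z; rewrite expr0 mul1r.
  rewrite /cauchy_rem E.
  exact: (cauchy_formula w1 w2 fD).
have rem_expn n w : cnorm w < r / 2 ->
    cauchy_rem f r 0 w = w ^+ n * cauchy_rem f r n w.
  elim: n w => [|n IH] w wr; first by rewrite expr0 mul1r.
  have wr1 := lt_trans wr r2r.
  rewrite (IH _ wr) (cauchy_rem_rec n r0 fD wr1).
  suff -> : cauchy_rem f r n 0 = 0 by rewrite add0r mulrA -exprSr.
  (* At a nonzero zero [v] of [f] the [n]-th remainder vanishes, so the coefficient equals minus [v]
     times the next remainder. For [v] close enough to 0 this has modulus below [B]. *)
  apply: contrapT => /eqP/cnorm_gt0; set B := cnorm _ => B0.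
  have rn0 : 0 < r ^+ n.+1 by rewrite exprn_gt0.
  have [|v [v0 vs fv]] := zeros (Num.min (r / 2) (B * r ^+ n.+1 / K)).
    by rewrite lt_min r20 divr_gt0// mulr_gt0.
  move: vs; rewrite lt_min => /andP[vr vB].
  have vr1 := lt_trans vr r2r.
  have /eqP : cauchy_rem f r 0 v = 0 by rewrite rem0// fv mul0r.
  rewrite (IH _ vr) mulf_eq0 expf_eq0 (negbTE v0) andbF /=.
  rewrite (cauchy_rem_rec n r0 fD vr1) addr_eq0 => /eqP rE.
  have : B <= cnorm v * (K / r ^+ n.+1).
    rewrite /B rE normcN Normc.normcM ler_wpM2l ?cnorm_ge0//.
    exact: HK (ltW vr).
  rewrite leNgt => /negP; apply; move: vB.
  by rewrite ltr_pdivlMr// mulrA ltr_pdivrMr.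
move=> w wr; have wr1 := lt_trans wr r2r; have [w1 w2] := inS _ wr1.
have : cauchy_rem f r 0 w = 0.
  apply: contrapT => /eqP/cnorm_gt0 B0.
  (* The bounds [(r / 2) ^+ n] for the power and [K / r ^+ n] for the remainder multiply to
     [K / 2 ^ n], which this [n] makes too small. *)
  have [|n nB] := @half_expn_lt R (cnorm (cauchy_rem f r 0 w) / K).
    exact: divr_gt0.
  move: nB; rewrite ltr_pdivlMr// ltNge => /negP; apply.
  have wn : cnorm (w ^+ n) <= (r / 2) ^+ n.
    elim: n => [|n IH]; first by rewrite !expr0 Normc.normc1.
    by rewrite !exprS Normc.normcM ler_pM ?cnorm_ge0 ?(ltW wr).
  rewrite (rem_expn n w wr) Normc.normcM.
  apply: le_trans (ler_pM (cnorm_ge0 _) (cnorm_ge0 _) wn (HK n w (ltW wr))) _.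
  have rn0 : r ^+ n != 0 by rewrite expf_neq0 ?gt_eqF.
  rewrite exprMn; move: (r ^+ n) (2^-1 ^+ n) rn0 => s h s0.
  by rewrite (_ : s * h * (K / s) = h * K)//; field.
rewrite rem0// => /eqP; rewrite mulf_eq0 (negbTE (rect_int_inv_subr_neq0 w1 w2)) orbF.
by move/eqP.
Qed.

(** * The identity theorem on a connected open set *)

Lemma identity_local (R : realType) (f : R[i] -> R[i]) (D : set R[i]) (z0 : R[i]) :
  open (D : set R[i]^o) -> holomorphic_on D f -> D z0 ->
  limit_point ([set z | D z /\ f z = 0] : set R[i]^o) z0 ->
  nbhs (z0 : R[i]^o) [set z | f z = 0].
Proof.
move=> oD fD Dz0 lim.
have /nbhs_cballP[d d0 dD] : nbhs (z0 : R[i]^o) D by exact: open_nbhs_nbhs.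
(* Points of the square of half-side [r] have modulus at most [2 * r], which is less than [d]; so
   the translated square stays in [D]. *)
pose r := d / 4; have r0 : 0 < r by rewrite divr_gt0.
have gD : derivable_square (fun z => f (z0 + z)) r.
  move=> z zr zi; have Dz : D (z0 + z).
    apply: dD; rewrite addrAC subrr add0r (le_lt_trans (cnorm_le_ReIm _))//.
    apply: (@le_lt_trans _ _ (r + r)); first by rewrite lerD// ler_norml.
    by rewrite /r; clear -d0; lra.
  apply/derivable1_diffP.
  apply: (@differentiable_comp R[i] R[i]^o R[i]^o R[i]^o (fun z => z0 + z) f).
    apply/derivable1_diffP; apply: derivableD; first exact: derivable_cst.
    exact: derivable_id.
  by apply/derivable1_diffP; exact: fD.
have gZ e : 0 < e -> exists w, [/\ w != 0, cnorm w < e & f (z0 + w) = 0].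
  move=> e0; have [|y [yz [_ fy] ye]] := lim [set z | cnorm (z - z0) < e].
    by apply/nbhs_cballP; exists e.
  by exists (y - z0); rewrite subr_eq0 [z0 + _]addrC subrK.
apply/nbhs_cballP; exists (r / 2); first by rewrite divr_gt0.
move=> w wz /=; have := identity_square0 r0 gD gZ wz.
by rewrite [z0 + _]addrC subrK.
Qed.

(** The interior [A] of the zero set is open. It is also closed relative to [D]: a point of [D] in
    its closure is a limit point of zeros, and [identity_local] puts it back in [A]. Connectedness
    then gives that [A] contains [D]. *)
Lemma identity_theorem (R : realType) (f : R[i] -> R[i]) (D : set R[i]) :
  open (D : set R[i]^o) -> connected (D : set R[i]^o) -> holomorphic_on D f ->
  (exists2 z, D z & limit_point ([set z | D z /\ f z = 0] : set R[i]^o) z) ->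
  forall z, D z -> f z = 0.
Proof.
move=> oD cD fD [z0 Dz0 lim].
pose A : set R[i]^o := interior ([set z | f z = 0] : set R[i]^o).
have AD : D `&` A = D.
  apply: cD.
  - by exists z0; split => //; exact: (identity_local oD fD Dz0 lim).
  - by exists A => //; exact: open_interior.
  exists (closure A); first exact: closed_closure.
  apply/seteqP; split=> z [Dz Az]; (split; first exact: Dz).
    exact: subset_closure Az.
  apply: (identity_local oD fD Dz) => U Uz.
  have Dn : nbhs (z : R[i]^o) D by exact: open_nbhs_nbhs.
  have /Az[y [Ay [Uy Dy]]] : nbhs (z : R[i]^o) (U `&` D) by exact: filterI.
  (* A limit point requires a zero different from [z]. If the closure only yields [z] itself, then
     [z] is interior to the zero set and the shift [z + m] is a zero for small [m]. *)
  have [yz|yz] := eqVneq y z; last first.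
    by exists y; split=> //; split=> //; exact: (nbhs_singleton Ay).
  move: Ay; rewrite yz => /nbhs_cballP[d d0 Hd].
  have /nbhs_cballP[e e0 He] : nbhs (z : R[i]^o) (U `&` D) by exact: filterI.
  pose m := Num.min d e / 2.
  have m0 : 0 < m by rewrite divr_gt0// lt_min d0.
  have : m < Num.min d e by rewrite ltr_pdivrMr// ltr_pMr ?ltr1n// lt_min d0.
  rewrite lt_min => /andP[md me].
  have nm : cnorm (z + m%:C%C - z) = m.
    by rewrite addrAC subrr add0r /= expr0n addr0 sqrtr_sqr gtr0_norm.
  have [Uw Dw] : (U `&` D) (z + m%:C%C) by apply: He; rewrite nm.
  exists (z + m%:C%C); split=> //.
    by rewrite -subr_eq0 addrAC subrr add0r eq_complex /= gt_eqF.
  by split=> //; apply: Hd; rewrite nm.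
by move=> z; rewrite -AD => -[_ Az]; exact: (nbhs_singleton Az).
Qed.

(** * Closure properties of holomorphic functions *)

Lemma eq_holomorphic_on (R : realType) (D : set R[i]) (f g : R[i] -> R[i]) :
  f =1 g -> holomorphic_on D f -> holomorphic_on D g.
Proof. by move=> /funext ->. Qed.

Lemma holomorphic_on_cst (R : realType) (D : set R[i]) (c : R[i]) :
  holomorphic_on D (fun=> c).
Proof. move=> z _; exact: derivable_cst. Qed.

Lemma holomorphic_onD (R : realType) (D : set R[i]) (f g : R[i] -> R[i]) :
  holomorphic_on D f -> holomorphic_on D g ->
  holomorphic_on D (fun z => f z + g z).
Proof.
move=> fD gD z Dz.
exact: (@derivableD R[i] R[i]^o R[i]^o f g z 1 (fD z Dz) (gD z Dz)).
Qed.

Lemma holomorphic_onM (R : realType) (D : set R[i]) (f g : R[i] -> R[i]) :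
  holomorphic_on D f -> holomorphic_on D g ->
  holomorphic_on D (fun z => f z * g z).
Proof.
move=> fD gD z Dz.
exact: (@derivableM R[i] R[i]^o f g z 1 (fD z Dz) (gD z Dz)).
Qed.

Lemma holomorphic_on_sum (R : realType) (D : set R[i]) (I : Type) (s : seq I)
    (f : I -> R[i] -> R[i]) : (forall i, holomorphic_on D (f i)) ->
  holomorphic_on D (fun z => \sum_(i <- s) f i z).
Proof.
move=> fD; elim: s => [|i s IH].
  apply: (@eq_holomorphic_on _ _ (fun=> 0)); last exact: holomorphic_on_cst.
  by move=> z; rewrite big_nil.
apply: (@eq_holomorphic_on _ _ (fun z => f i z + \sum_(j <- s) f j z)).
  by move=> z; rewrite big_cons.
exact: (holomorphic_onD (fD i) IH).
Qed.

Lemma holomorphic_on_prod (R : realType) (D : set R[i]) (I : Type) (s : seq I)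
    (f : I -> R[i] -> R[i]) : (forall i, holomorphic_on D (f i)) ->
  holomorphic_on D (fun z => \prod_(i <- s) f i z).
Proof.
move=> fD; elim: s => [|i s IH].
  apply: (@eq_holomorphic_on _ _ (fun=> 1)); last exact: holomorphic_on_cst.
  by move=> z; rewrite big_nil.
apply: (@eq_holomorphic_on _ _ (fun z => f i z * \prod_(j <- s) f j z)).
  by move=> z; rewrite big_cons.
exact: (holomorphic_onM (fD i) IH).
Qed.

Lemma holomorphic_onX (R : realType) (D : set R[i]) (f : R[i] -> R[i]) n :
  holomorphic_on D f -> holomorphic_on D (fun z => f z ^+ n).
Proof.
move=> fD; apply: (@eq_holomorphic_on _ _ (fun z => \prod_(i < n) f z)).
  by move=> z; rewrite prodr_const card_ord.
exact: (holomorphic_on_prod (fun=> fD)).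
Qed.

Lemma holomorphic_onMn (R : realType) (D : set R[i]) (f : R[i] -> R[i]) n :
  holomorphic_on D f -> holomorphic_on D (fun z => f z *+ n).
Proof.
move=> fD; apply: (@eq_holomorphic_on _ _ (fun z => \sum_(i < n) f z)).
  by move=> z; rewrite sumr_const card_ord.
exact: (holomorphic_on_sum (fun=> fD)).
Qed.

(** The determinant unfolds to the Leibniz sum of signed products of entries. *)
Lemma holomorphic_on_det (R : realType) (D : set R[i]) n
    (A : R[i] -> 'M[R[i]]_n) : (forall i j, holomorphic_on D (fun z => A z i j)) ->
  holomorphic_on D (fun z => \det (A z)).
Proof.
move=> AD; apply: holomorphic_on_sum => s; apply: holomorphic_onM.
  exact: holomorphic_on_cst.
by apply: holomorphic_on_prod => i; exact: AD.
Qed.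

Lemma holomorphic_on_meval (R : realType) (D : set R[i]) n
    (v : R[i] -> 'I_n -> R[i]) (p : mpoly.mpoly n R[i]) :
  (forall i, holomorphic_on D (fun z => v z i)) ->
  holomorphic_on D (fun z => mpoly.meval (v z) p).
Proof.
move=> vD; apply: holomorphic_on_sum => m; apply: holomorphic_onM.
  exact: holomorphic_on_cst.
by apply: holomorphic_on_prod => i; exact: (holomorphic_onX (vD i)).
Qed.

Lemma holomorphic_on_px_coef (R : realType) (D : set R[i]) m n k
    (q : 'I_k -> mpoly.mpoly (m * n) R[i]) (F : R[i] -> 'M[R[i]]_(m, n)) j :
  (forall i j, holomorphic_on D (fun z => F z i j)) ->
  holomorphic_on D (fun z => (px q (F z))`_j).
Proof.
move=> FD; apply: (@eq_holomorphic_on _ _ (fun z => (j == k)%:R +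
    \sum_(i < k) mpoly.meval (mx_entries (F z)) (q i) * (j == i)%:R)).
  move=> z; rewrite /px coefD coefXn coef_sum; congr (_ + _).
  by apply: eq_bigr => i _; rewrite coefCM coefXn.
apply: holomorphic_onD; first exact: holomorphic_on_cst.
apply: holomorphic_on_sum => i; apply: holomorphic_onM; last first.
  exact: holomorphic_on_cst.
apply: holomorphic_on_meval => l; case/mxvec_indexP: l => a b.
apply: (@eq_holomorphic_on _ _ (fun z => F z a b)); last exact: FD.
by move=> z; rewrite /mx_entries mxvecE.
Qed.

(** * Resultants and repeated roots *)

(** The Sylvester matrix has a dimension computed from the sizes of the polynomials. Naming the
    degrees makes that dimension fixed, so that polynomials varying with a parameter give one
    matrix-valued function. *)
Lemma resultant_det (K : nzRingType) (p q : {poly K}) dp dq :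
  size p = dp.+1 -> size q = dq.+1 ->
  resultant p q = \det (\matrix_(i < dq + dp, j < dq + dp)
    match fintype.split i with
    | inl l => p`_(j - l)%N *+ (l <= j)%N
    | inr l => q`_(j - l)%N *+ (l <= j)%N
    end).
Proof.
move=> /(congr1 predn)/= <- /(congr1 predn)/= <-; congr (\det _).
by apply/matrixP => i j; rewrite Sylvester_mxE mxE.
Qed.

Lemma size_px (K : comNzRingType) m n k (q : 'I_k -> mpoly.mpoly (m * n) K)
  (A : 'M[K]_(m, n)) : size (px q A) = k.+1.
Proof.
rewrite /px size_polyDl size_polyXn// ltnS.
apply: leq_trans (size_sum _ _ _) _; apply/bigmax_leqP => i _.
rewrite mul_polyC; apply: leq_trans (size_scale_leq _ _) _.
by rewrite size_polyXn.
Qed.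

(** In characteristic zero, multiplying the leading coefficient by its positive exponent cannot give
    0. *)
Lemma size_deriv_numField (K : numFieldType) (p : {poly K}) :
  size p^`() = (size p).-1.
Proof.
have [->|p0] := eqVneq p 0; first by rewrite derivC size_poly0.
apply/eqP; rewrite eqn_leq -ltnS prednK ?lt_size_deriv ?size_poly_gt0//=.
case sp : (size p).-1 => [//|n]; rewrite ltnNge; apply/negP => /leq_sizeP/(_ n (leqnn n)).
move=> /eqP; rewrite coef_deriv mulrn_eq0 /= -sp -lead_coefE lead_coef_eq0.
by rewrite (negbTE p0).
Qed.

(** If [p = s * ('X - z%:P)], the product rule makes the derivative at [z] equal to [s.[z]]; a
    second factor exists exactly when this vanishes. *)
Lemma mup_ge2 (K : fieldType) (p : {poly K}) (z : K) : p != 0 ->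
  (2 <= mup z p)%N = root p z && root p^`() z.
Proof.
move=> p0; rewrite mup_geq// expr2; apply/idP/andP => [|[rp rp']].
  move=> /dvdpP[s ->]; rewrite mulrA derivM derivXsubC mulr1 /root hornerD.
  by rewrite !hornerM hornerXsubC subrr !mulr0 addr0 eqxx.
move: rp; rewrite -dvdp_XsubCl => /dvdpP[s ps].
rewrite ps dvdp_mul2r ?polyXsubC_eq0// dvdp_XsubCl.
by move: rp'; rewrite ps derivM derivXsubC /root !hornerE subrr mulr0 add0r.
Qed.

(** The resultant vanishes exactly when the gcd of the polynomial and its derivative is nonconstant.
    Over an algebraically closed field this means a common root, hence a multiple root. *)
Lemma repeated_zeros_resultant (K : numClosedFieldType) m n k
    (q : 'I_k -> mpoly.mpoly (m * n) K) (A : 'M[K]_(m, n)) :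
  (0 < k)%N ->
  repeated_zeros q A <-> resultant (px q A) (px q A)^`() = 0.
Proof.
move=> k0; have sp := size_px q A; have p0 : px q A != 0 by rewrite -size_poly_gt0 sp.
have g0 : (0 < size (gcdp (px q A) (px q A)^`()))%N.
  by rewrite size_poly_gt0 gcdp_eq0 (negbTE p0).
split=> [[z]|/eqP]; rewrite ?mup_ge2//.
  rewrite -root_gcd => rz; apply/eqP; rewrite resultant_eq0.
  by apply: root_size_gt1 rz; rewrite -size_poly_gt0.
rewrite resultant_eq0 => s1.
have /closed_rootP[z] : size (gcdp (px q A) (px q A)^`()) != 1%N by rewrite gtn_eqF.
by rewrite root_gcd -mup_ge2// => rz; exists z.
Qed.

Theorem theorem5p3 (R : realType) (m n k : nat)
  (q : 'I_k -> mpoly.mpoly (m * n) R[i])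
  (D : set R[i]) (F : R[i] -> 'M[R[i]]_(m, n)) :
  (2 <= k <= m * n)%N ->
  in_Pk q ->
  open (D : set R[i]^o) -> connected (D : set R[i]^o) ->
  (forall (i : 'I_m) (j : 'I_n), holomorphic_on D (fun z => F z i j)) ->
  let Z := [set z | D z /\ repeated_zeros q (F z)] in
  Z = D \/ (forall z, D z -> ~ limit_point (Z : set R[i]^o) z).
Proof.
move=> /andP[k2 _] _ oD cD FD Z; have k0 : (0 < k)%N by exact: leq_trans k2.
pose g z := resultant (px q (F z)) (px q (F z))^`().
have ZE : Z = [set z | D z /\ g z = 0].
  by apply/seteqP; split=> z [Dz] /(repeated_zeros_resultant q (F z) k0).
have gD : holomorphic_on D g.
  have sp z := size_px q (F z).
  (* Since [px] has degree exactly [k] at every [z], its derivative has degree exactly [k.-1]; hence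
     a single Sylvester size serves for all [z]. *)
  have sp' z : size (px q (F z))^`() = k.-1.+1.
    by rewrite size_deriv_numField sp prednK.
  apply: (@eq_holomorphic_on _ _ _ _ (fun z => esym (resultant_det (sp z) (sp' z)))).
  apply: holomorphic_on_det => i j; case si : (fintype.split i) => [l|l].
    apply: (@eq_holomorphic_on _ _ (fun z => (px q (F z))`_(j - l)%N *+ (l <= j)%N)).
      by move=> z; rewrite mxE si.
    exact: (holomorphic_onMn (holomorphic_on_px_coef FD)).
  apply: (@eq_holomorphic_on _ _
      (fun z => (px q (F z))`_(j - l)%N.+1 *+ (j - l)%N.+1 *+ (l <= j)%N)).
    by move=> z; rewrite mxE si coef_deriv.
  exact: (holomorphic_onMn (holomorphic_onMn (holomorphic_on_px_coef FD))).
have [lim|nolim] := pselect (exists2 z, D z & limit_point (Z : set R[i]^o) z).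
  left; apply/seteqP; split=> [z []//|z Dz]; rewrite ZE; split=> //.
  by apply: (identity_theorem oD cD gD _ Dz); rewrite -ZE.
by right=> z Dz lim; apply: nolim; exists z.
Qed.
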